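(* Let $k$ be a commutative ring, let $\mathcal{T}$ be a $k$-linear triangulated category classically generated by an object $G$, and let $H:\mathcal{T}^{\mathrm{op}}\to k\text{-Mod}$ be a ($k$-linear) cohomological functor. Then $H$ is locally finitely presented if and only if there is a directed system $A_1\xrightarrow{f_1}A_2\xrightarrow{f_2}\cdots$ in $\mathcal{T}$ that is almost constant on $\{G[i]\}_{i\in\mathbb{Z}}$ and an isomorphism $\operatorname{colim}h_{A_i}\xrightarrow{\sim}H$.
   Context: $k\text{-Mod}$ is the category of all $k$-modules. A functor $H:\mathcal{T}^{\mathrm{op}}\to k\text{-Mod}$ is cohomological if for every distinguished triangle $X\to Y\to Z\to X[1]$ the sequence $H(Z)\to H(Y)\to H(X)$ is exact. For $C\in\mathcal{T}$, $h_C=\operatorname{Hom}_{\mathcal{T}}(-,C)$. $\mathcal{T}$ is classically generated by $G$ if $\mathcal{T}$ is the smallest thick subcategory of $\mathcal{T}$ containing $G$. $H$ is locally finitely generated if for every $X\in\mathcal{T}$ there are $D\in\mathcal{T}$ and a natural transformation $\alpha:h_D\to H$ such that $\alpha(X[i])$ is surjective for all $i\in\mathbb{Z}$. $H$ is locally finitely presented if it is locally finitely generated and, for every $E\in\mathcal{T}$, the kernel of any map $h_E\to H$ is locally finitely generated. A system of abelian groups $V_1\xrightarrow{f_1}V_2\xrightarrow{f_2}\cdots$ is almost constant if for every $i\ge1$ the canonical map $V_i\to V=\operatorname{colim}V_j$ induces an isomorphism $V_i/\ker f_i\xrightarrow{\sim}V$. A directed system $A_1\xrightarrow{f_1}A_2\xrightarrow{f_2}\cdots$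 of objects of $\mathcal{T}$ is almost constant on a subcategory $\mathcal{I}$ if for every $X\in\mathcal{I}$ the system $h_{A_1}(X)\to h_{A_2}(X)\to\cdots$ is almost constant. *)

(* Defs.v *)
(* Mathematical Components; the axioms of mathcomp.classical.boolp serve to
   turn undecidable membership predicates into boolean ones. *)
From HB Require Import structures.
From mathcomp Require Import all_boot all_order all_algebra.
From mathcomp Require Import generic_quotient ring_quotient.
From mathcomp Require Import boolp.

Set Implicit Arguments.
Unset Strict Implicit.
Unset Printing Implicit Defensive.

Import GRing.Theory.
Local Open Scope ring_scope.
Local Open Scope quotient_scope.

Definition additive_ker (U V : zmodType) (u : {additive U -> V}) : {pred U} :=
  fun x => u x == 0.

Fact additive_ker_zmod (U V : zmodType) (u : {additive U -> V}) :
  zmod_closed (additive_ker u).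
Proof.
split=> [|x y]; rewrite ?unfold_in /additive_ker ?raddf0 //.
by move=> /eqP ux /eqP uy; rewrite raddfB ux uy subr0.
Qed.

HB.instance Definition _ (U V : zmodType) (u : {additive U -> V}) :=
  GRing.isZmodClosed.Build U (additive_ker u) (additive_ker_zmod u).

Section LinearKernel.
Variables (k : comPzRingType) (U V : lmodType k) (u : {linear U -> V}).

Definition ker_pred : {pred U} := fun x => u x == 0.

Fact ker_pred_submod : submod_closed ker_pred.
Proof.
split=> [|a x y]; rewrite ?unfold_in /ker_pred ?linear0 //.
by move=> /eqP ux /eqP uy; rewrite linearP ux uy scaler0 addr0.
Qed.
HB.instance Definition _ := GRing.isSubmodClosed.Build k U ker_pred ker_pred_submod.

Record linear_ker := LinearKer { ker_val :> U; _ : ker_val \in ker_pred }.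

HB.instance Definition _ := [isSub for ker_val].
HB.instance Definition _ := [Choice of linear_ker by <:].
HB.instance Definition _ := [SubChoice_isSubLmodule of linear_ker by <:].

End LinearKernel.

Section SeqColim.
Variables (V : nat -> zmodType) (f : forall i, {additive V i -> V i.+1}).

Definition seq_prod : Type := forall i, V i.
HB.instance Definition _ := Choice.on seq_prod.

Definition sp_zero : seq_prod := fun i => 0.
Definition sp_opp (s : seq_prod) : seq_prod := fun i => - s i.
Definition sp_add (s t : seq_prod) : seq_prod := fun i => s i + t i.

Fact sp_addA : associative sp_add.
Proof. by move=> s t r; apply: functional_extensionality_dep => i; rewrite /sp_add addrA. Qed.
Fact sp_addC : commutative sp_add.
Proof. by move=> s t; apply: functional_extensionality_dep => i; rewrite /sp_add addrC. Qed.
Fact sp_add0 : left_id sp_zero sp_add.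
Proof. by move=> s; apply: functional_extensionality_dep => i; rewrite /sp_add add0r. Qed.
Fact sp_addN : left_inverse sp_zero sp_opp sp_add.
Proof. by move=> s; apply: functional_extensionality_dep => i; rewrite /sp_add addNr. Qed.

HB.instance Definition _ :=
  GRing.isZmodule.Build seq_prod sp_addA sp_addC sp_add0 sp_addN.

Definition eventually_compatible : {pred seq_prod} :=
  fun s => `[< exists N, forall n, (N <= n)%N -> s n.+1 = f n (s n) >].

Fact eventually_compatible_zmod : zmod_closed eventually_compatible.
Proof.
split=> [|s t]; rewrite ?unfold_in.
  by apply/asboolP; exists 0%N => n _; rewrite raddf0.
move=> /asboolP[M sM] /asboolP[N tN]; apply/asboolP; exists (maxn M N) => n.
rewrite geq_max => /andP[Mn Nn].
rewrite [LHS]/(s n.+1 - t n.+1) sM // tN //.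
exact: (esym (raddfB (f n) (s n) (t n))).
Qed.
HB.instance Definition _ := GRing.isZmodClosed.Build seq_prod
  eventually_compatible eventually_compatible_zmod.

Record germ := Germ {
  germ_val : seq_prod;
  _ : germ_val \in eventually_compatible
}.
HB.instance Definition _ := [isSub for germ_val].
HB.instance Definition _ := [Choice of germ by <:].
HB.instance Definition _ := [SubChoice_isSubZmodule of germ by <:].

Fact germB (s t : germ) n :
  germ_val (s - t) n = germ_val s n - germ_val t n.
Proof. exact: (congr1 (fun r : seq_prod => r n) (raddfB (val : germ -> seq_prod) s t)). Qed.

Fact germD (s t : germ) n :
  germ_val (s + t) n = germ_val s n + germ_val t n.
Proof. exact: (congr1 (fun r : seq_prod => r n) (raddfD (val : germ -> seq_prod) s t)). Qed.

Definition eventually_zero : {pred germ} :=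
  fun s => `[< exists N, forall n, (N <= n)%N -> germ_val s n = 0 >].

Fact eventually_zero_zmod : zmod_closed eventually_zero.
Proof.
split=> [|s t]; rewrite ?unfold_in.
  by apply/asboolP; exists 0%N => n _.
move=> /asboolP[M sM] /asboolP[N tN]; apply/asboolP; exists (maxn M N) => n.
rewrite geq_max => /andP[Mn Nn].
by rewrite germB sM // tN // subr0.
Qed.
HB.instance Definition _ := GRing.isZmodClosed.Build germ
  eventually_zero eventually_zero_zmod.

(* The colimit of V 0 -> V 1 -> ... is realized as the group of sequences
   (s n) in the product with s n.+1 = f n (s n) for large n, modulo equality
   for large n. The universal property is seq_colim_universal below. *)
Definition seq_colim : Type := Quotient.quot eventually_zero.
HB.instance Definition _ := GRing.Zmodule.on seq_colim.
HB.instance Definition _ := EqQuotient.on seq_colim.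

(* The sequence 0, ..., 0, x, f i x, f i.+1 (f i x), ... with x at place i. *)
Fixpoint push_seq i (x : V i) (n : nat) : V n :=
  match n return V n with
  | 0 => dfwith (fun j => 0 : V j) x 0
  | m.+1 => if (i <= m)%N then f m (push_seq x m)
            else dfwith (fun j => 0 : V j) x m.+1
  end.

Fact push_seq_compatible i (x : V i) :
  (push_seq x : seq_prod) \in eventually_compatible.
Proof. by apply/asboolP; exists i => n /= ->. Qed.

Definition seq_colim_in i (x : V i) : seq_colim :=
  \pi_seq_colim (Germ (push_seq_compatible x)).

Lemma eq_seq_colim (s t : germ) :
  (\pi_seq_colim s = \pi_seq_colim t) <->
  exists N, forall n, (N <= n)%N -> germ_val s n = germ_val t n.
Proof.
have -> : (\pi_seq_colim s = \pi_seq_colim t) <-> (s - t \in eventually_zero).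
  by rewrite Quotient.idealrBE; split=> [->|/eqP].
split=> [/asboolP[N stN]|[N stN]]; [|apply/asboolP]; exists N => n /stN.
  by rewrite germB => /eqP; rewrite subr_eq0 => /eqP.
by rewrite germB => ->; rewrite subrr.
Qed.

Fact push_seqB i (x y : V i) n : push_seq (x - y) n = push_seq x n - push_seq y n.
Proof.
have dfwithB m : dfwith (fun j => 0 : V j) (x - y) m =
    dfwith (fun j => 0 : V j) x m - dfwith (fun j => 0 : V j) y m.
  have [<-|im] := eqVneq i m; first by rewrite !dfwith_in.
  by rewrite !dfwith_out // subrr.
elim: n => [|n IHn] /=; first exact: dfwithB.
by case: ifP => _; rewrite ?dfwithB // IHn raddfB.
Qed.

Fact push_seq_id i (x : V i) : push_seq x i = x.
Proof. by case: i x => [|i] x /=; rewrite ?ltnn dfwith_in. Qed.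

Fact seq_colim_in_additive i : zmod_morphism (@seq_colim_in i).
Proof.
move=> x y; rewrite /seq_colim_in -[RHS](raddfB \pi_seq_colim).
apply/eq_seq_colim; exists 0%N => n _; exact: push_seqB.
Qed.
HB.instance Definition _ i := GRing.isZmodMorphism.Build (V i) seq_colim
  (@seq_colim_in i) (@seq_colim_in_additive i).

Lemma seq_colim_in_f i (x : V i) : seq_colim_in (f i x) = seq_colim_in x.
Proof.
apply/eq_seq_colim; exists i.+1; elim=> // n IHn.
rewrite ltnS leq_eqVlt => /predU1P[<-|lt_in].
  by rewrite /= ltnn dfwith_in leqnn push_seq_id.
by rewrite /= lt_in (ltnW lt_in); congr (f n _); apply: IHn.
Qed.

Lemma seq_colim_surj (c : seq_colim) : exists i (x : V i), c = seq_colim_in x.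
Proof.
elim/quotW: c => s; have /asboolP[N sN] := valP s.
exists N, (germ_val s N); apply/eq_seq_colim; exists N; elim=> [|n IHn].
  by rewrite leqn0 => /eqP N0; move: (s); rewrite N0 => t /=; rewrite dfwith_in.
rewrite leq_eqVlt => /predU1P[<-|lt_Nn]; first by rewrite /= push_seq_id.
have le_Nn : (N <= n)%N by [].
have sSn : germ_val s n.+1 = f n (germ_val s n) := sN n le_Nn.
by rewrite sSn [RHS]/= le_Nn IHn.
Qed.

Lemma seq_colim_in_eq0 i (x : V i) :
  seq_colim_in x = 0 <-> exists2 n, (i <= n)%N & push_seq x n = 0.
Proof.
have -> : (0 : seq_colim) = \pi_seq_colim 0 by rewrite raddf0.
split=> [/eq_seq_colim[N xN]|[n le_in xn]].
  exists (maxn i N); rewrite ?leq_maxl //.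
  exact: (xN _ (leq_maxr i N)).
apply/eq_seq_colim; exists n; elim=> [|m IHm].
  by rewrite leqn0 => /eqP n0; rewrite n0 in xn.
rewrite leq_eqVlt => /predU1P[<-|lt_nm]; first exact: xn.
have IH : push_seq x m = 0 by exact: IHm.
by rewrite /= (leq_trans le_in (ltnSE lt_nm)) IH raddf0.
Qed.

Lemma seq_colim_universal (W : zmodType) (g : forall i, {additive V i -> W}) :
  (forall i x, g i.+1 (f i x) = g i x) ->
  exists! h : seq_colim -> W,
    zmod_morphism h /\ forall i x, h (@seq_colim_in i x) = g i x.
Proof.
move=> g_f.
have gE i (x : V i) n : (i <= n)%N -> g n (push_seq x n) = g i x.
  elim: n => [|n IHn]; first by rewrite leqn0 => /eqP i0; subst i; rewrite push_seq_id.
  rewrite leq_eqVlt => /predU1P[i_n|lt_in]; first by subst i; rewrite push_seq_id.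
  by rewrite /= (ltnSE lt_in) g_f IHn // (ltnSE lt_in).
have g_eq i (x : V i) j (y : V j) :
    seq_colim_in x = seq_colim_in y -> g i x = g j y.
  move=> /eq_seq_colim[N xy]; set n := maxn N (maxn i j).
  rewrite -(gE i x n) -?(gE j y n) ?leq_max ?leqnn ?orbT //.
  by congr (g n _); apply: (xy n); rewrite leq_max leqnn.
pose h (c : seq_colim) : W :=
  let ix := cid (seq_colim_surj c) in g (projT1 ix) (projT1 (cid (projT2 ix))).
have hE i (x : V i) : h (seq_colim_in x) = g i x.
  by rewrite /h; case: cid => j /= ex; case: cid => y /= xy; apply/esym/g_eq.
exists h; split; first split=> // c d.
  have [i [x ->]] := seq_colim_surj c; have [j [y ->]] := seq_colim_surj d.
  set n := maxn i j.
  have lift m (z : V m) : (m <= n)%N ->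
      seq_colim_in z = seq_colim_in (push_seq z n).
    elim: (n) => [|p IHp].
      by rewrite leqn0 => /eqP m0; subst m; rewrite push_seq_id.
    rewrite leq_eqVlt => /predU1P[m_p|lt_mp]; first by subst m; rewrite push_seq_id.
    by rewrite [push_seq _ _]/= (ltnSE lt_mp) seq_colim_in_f IHp // (ltnSE lt_mp).
  rewrite (lift i x) ?leq_maxl // (lift j y) ?leq_maxr //.
  by rewrite -raddfB !hE raddfB.
move=> h' [_ h'E]; apply/funext => c.
by have [i [x ->]] := seq_colim_surj c; rewrite hE h'E.
Qed.

End SeqColim.

Section LinearSeqColim.
Variables (k : comPzRingType) (V : nat -> lmodType k).
Variables (f : forall i, {linear V i -> V i.+1}).

Definition lin_colim : Type := @seq_colim (fun i => V i) (fun i => f i).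
HB.instance Definition _ := GRing.Zmodule.on lin_colim.

Local Notation germ := (@germ (fun i => V i) (fun i => f i)).
Local Notation colim_in := (seq_colim_in (fun i => f i)).

Fact germ_scale_compatible (a : k) (s : germ) :
  ((fun n => a *: germ_val s n) : seq_prod (fun i => V i))
    \in eventually_compatible (fun i => f i).
Proof.
have /asboolP[N sN] := valP s; apply/asboolP; exists N => n Nn.
by rewrite [germ_val s n.+1](sN n Nn) /= linearZ.
Qed.

Definition lin_colim_scale (a : k) (c : lin_colim) : lin_colim :=
  \pi_(seq_colim (fun i => f i)) (Germ (germ_scale_compatible a (repr c))).

Local Notation pi := (\pi_(seq_colim (fun i => f i))).

Fact lin_colim_scale_pi a (s : germ) :
  lin_colim_scale a (pi s) = pi (Germ (germ_scale_compatible a s)).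
Proof.
have /eq_seq_colim[N sN] : pi (repr (pi s)) = pi s by rewrite reprK.
by apply/eq_seq_colim; exists N => n Nn /=; rewrite sN.
Qed.

Fact lin_colim_scaleA a b c :
  lin_colim_scale a (lin_colim_scale b c) = lin_colim_scale (a * b) c.
Proof.
elim/quotW: c => s; rewrite (lin_colim_scale_pi b s) !lin_colim_scale_pi.
by apply/eq_seq_colim; exists 0%N => n _ /=; rewrite scalerA.
Qed.

Fact lin_colim_scale1 c : lin_colim_scale 1 c = c.
Proof.
elim/quotW: c => s; rewrite !lin_colim_scale_pi.
by apply/eq_seq_colim; exists 0%N => n _ /=; rewrite scale1r.
Qed.

Fact lin_colim_scaleDr a c d :
  lin_colim_scale a (c + d) = lin_colim_scale a c + lin_colim_scale a d.
Proof.
move: c d; elim/quotW=> s; elim/quotW=> t.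
rewrite -[pi s + pi t](raddfD pi) !lin_colim_scale_pi -[RHS](raddfD pi).
apply/eq_seq_colim; exists 0%N => n _; exact: scalerDr.
Qed.

Fact lin_colim_scaleDl c a b :
  lin_colim_scale (a + b) c = lin_colim_scale a c + lin_colim_scale b c.
Proof.
elim/quotW: c => s; rewrite !lin_colim_scale_pi -[RHS](raddfD pi).
apply/eq_seq_colim; exists 0%N => n _; exact: scalerDl.
Qed.

HB.instance Definition _ := GRing.Zmodule_isLmodule.Build k lin_colim
  lin_colim_scaleA lin_colim_scale1 lin_colim_scaleDr lin_colim_scaleDl.


Lemma lin_colim_scale_in a i (x : V i) :
  a *: (colim_in x : lin_colim) = colim_in (a *: x).
Proof.
rewrite [LHS]lin_colim_scale_pi; apply/eq_seq_colim; exists 0%N => n _.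
have dfwithZ m : a *: dfwith (fun j => 0 : V j) x m =
    dfwith (fun j => 0 : V j) (a *: x) m.
  have [<-|im] := eqVneq i m; first by rewrite !dfwith_in.
  by rewrite !dfwith_out // scaler0.
suff : a *: push_seq (fun i => f i) x n = push_seq (fun i => f i) (a *: x) n by [].
elim: n => [|n IHn]; first exact: dfwithZ.
rewrite /=; case: ifP => _; last exact: dfwithZ.
by rewrite -IHn linearZ.
Qed.

Definition lin_colim_in i (x : V i) : lin_colim := colim_in x.

Fact lin_colim_in_linear i : linear (@lin_colim_in i).
Proof.
move=> a x y; rewrite lin_colim_scale_in.
exact: (raddfD (colim_in (i := i)) (a *: x) y).
Qed.
HB.instance Definition _ i := GRing.isLinear.Build k (V i) lin_colim *:%R
  (@lin_colim_in i) (@lin_colim_in_linear i).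

Lemma lin_colim_surj (c : lin_colim) : exists i (x : V i), c = lin_colim_in x.
Proof. exact: seq_colim_surj. Qed.

Lemma lin_colim_in_f i (x : V i) : lin_colim_in (f i x) = lin_colim_in x.
Proof. exact: (seq_colim_in_f (fun i => f i)). Qed.

Lemma lin_colim_universal (W : lmodType k) (g : forall i, {linear V i -> W}) :
  (forall i x, g i.+1 (f i x) = g i x) ->
  exists! h : lin_colim -> W,
    linear h /\ forall i x, h (@lin_colim_in i x) = g i x.
Proof.
move=> gf; have [h [[hB hin] h_uniq]] :=
  @seq_colim_universal (fun i => V i) (fun i => f i) W (fun i => g i) gf.
have hE i (x : V i) : h (lin_colim_in x) = g i x by exact: hin.
have hZ a (c : lin_colim) : h (a *: c) = a *: h c.
  by have [i [x ->]] := lin_colim_surj c; rewrite -linearZ !hE linearZ.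
have hb (c d : lin_colim) : h (c - d) = h c - h d by exact: hB.
have h0 : h (0 : lin_colim) = 0 by have := hb 0 0; rewrite !subrr.
have hD (c d : lin_colim) : h (c + d) = h c + h d.
  by rewrite -[d in LHS]opprK hb -(sub0r d) hb h0 sub0r opprK.
exists h; split; first by split=> // a c d; rewrite (hD (a *: c) d) hZ.
move=> h' [h'L h'E]; apply: h_uniq; split; last exact: h'E.
suff h'B (c d : lin_colim) : h' (c - d) = h' c - h' d by move=> c d; exact: h'B.
by rewrite addrC -[- d]scaleN1r h'L scaleN1r addrC.
Qed.

End LinearSeqColim.

Section LinColimMap.
Variables (k : comPzRingType) (V W : nat -> lmodType k).
Variables (f : forall i, {linear V i -> V i.+1}).
Variables (g : forall i, {linear W i -> W i.+1}).
Variables (u : forall i, {linear V i -> W i}).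
Hypothesis uf : forall i x, u i.+1 (f i x) = g i (u i x).

Fact germ_map_compatible (s : @germ (fun i => V i) (fun i => f i)) :
  ((fun n => u n (germ_val s n)) : seq_prod (fun i => W i))
    \in eventually_compatible (fun i => g i).
Proof.
have /asboolP[N sN] := valP s; apply/asboolP; exists N => n Nn.
by rewrite [germ_val s n.+1](sN n Nn) /= uf.
Qed.

Definition lin_colim_map (c : lin_colim f) : lin_colim g :=
  \pi_(seq_colim (fun i => g i)) (Germ (germ_map_compatible (repr c))).

Fact lin_colim_map_pi s :
  lin_colim_map (\pi_(seq_colim (fun i => f i)) s) =
  \pi_(seq_colim (fun i => g i)) (Germ (germ_map_compatible s)).
Proof.
have /eq_seq_colim[N sN] : \pi_(seq_colim (fun i => f i))
    (repr (\pi_(seq_colim (fun i => f i)) s)) = \pi_(seq_colim (fun i => f i)) s.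
  by rewrite reprK.
by apply/eq_seq_colim; exists N => n Nn /=; rewrite sN.
Qed.

Lemma lin_colim_map_in i (x : V i) :
  lin_colim_map (lin_colim_in f x) = lin_colim_in g (u i x).
Proof.
rewrite lin_colim_map_pi; apply/eq_seq_colim; exists 0%N => n _ /=.
have dfwithU m : u m (dfwith (fun j => 0 : V j) x m) =
    dfwith (fun j => 0 : W j) (u i x) m.
  have [<-|im] := eqVneq i m; first by rewrite !dfwith_in.
  by rewrite !dfwith_out // linear0.
elim: n => [|n IHn] /=; first exact: dfwithU.
by case: ifP => _; [rewrite uf IHn | exact: dfwithU].
Qed.

Fact lin_colim_map_linear : linear lin_colim_map.
Proof.
move=> a; elim/quotW=> s; elim/quotW=> t.
rewrite [a *: _](lin_colim_scale_pi a s).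
rewrite -[X in lin_colim_map X](raddfD \pi_(seq_colim (fun i => f i))).
rewrite !lin_colim_map_pi [a *: _](lin_colim_scale_pi a).
rewrite -[RHS](raddfD \pi_(seq_colim (fun i => g i))).
apply/eq_seq_colim; exists 0%N => n _; exact: linearP.
Qed.
HB.instance Definition _ := GRing.isLinear.Build k (lin_colim f) (lin_colim g)
  *:%R lin_colim_map lin_colim_map_linear.

End LinColimMap.

(* Here V_i is indexed from 0. The quotient V_i / ker f_i is that of
   ring_quotient, with projection \pi, so phi is the map induced by the
   canonical map V_i -> colim V_j. *)
Definition almost_constant (V : nat -> zmodType)
    (f : forall i, {additive V i -> V i.+1}) : Prop :=
  forall i, exists phi : {additive Quotient.quot (additive_ker (f i)) -> seq_colim f},
    bijective phi /\
    forall x : V i, phi (\pi_(Quotient.quot (additive_ker (f i))) x) = seq_colim_in f x.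

Record linCategory (k : comPzRingType) := LinCategory {
  obj :> Type;
  Mor : obj -> obj -> lmodType k;
  idmor : forall X, Mor X X;
  compm : forall X Y Z, Mor Y Z -> Mor X Y -> Mor X Z;
  comp1m : forall X Y (f : Mor X Y), compm (idmor Y) f = f;
  compm1 : forall X Y (f : Mor X Y), compm f (idmor X) = f;
  compmA : forall X Y Z W (h : Mor Z W) (g : Mor Y Z) (f : Mor X Y),
    compm h (compm g f) = compm (compm h g) f;
  comp_linearl : forall X Y Z (f : Mor X Y), linear (fun g : Mor Y Z => compm g f);
  comp_linearr : forall X Y Z (g : Mor Y Z), linear (fun f : Mor X Y => compm g f)
}.

Arguments Mor {k l} X Y.
Arguments idmor {k l} X.
Arguments compm {k l X Y Z} g f.
Notation "g <o> f" := (compm g f) (at level 40, left associativity).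

Section CategoryTheory.
Variables (k : comPzRingType) (C : linCategory k).

Definition is_iso (X Y : C) (f : Mor X Y) : Prop :=
  exists g : Mor Y X, g <o> f = idmor X /\ f <o> g = idmor Y.

Definition is_zero_object (Z : C) : Prop :=
  forall X, (forall f g : Mor X Z, f = g) /\ (forall f g : Mor Z X, f = g).

Definition is_biproduct (X Y B : C)
    (i1 : Mor X B) (i2 : Mor Y B) (p1 : Mor B X) (p2 : Mor B Y) : Prop :=
  [/\ p1 <o> i1 = idmor X, p2 <o> i2 = idmor Y, p1 <o> i2 = 0, p2 <o> i1 = 0
    & i1 <o> p1 + i2 <o> p2 = idmor B].

Definition additive_category : Prop :=
  (exists Z : C, is_zero_object Z) /\
  (forall X Y : C, exists (B : C) (i1 : Mor X B) (i2 : Mor Y B)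
     (p1 : Mor B X) (p2 : Mor B Y), is_biproduct i1 i2 p1 p2).

Definition postcomp (X Y Z : C) (g : Mor Y Z) (f : Mor X Y) : Mor X Z := g <o> f.
HB.instance Definition _ X Y Z (g : Mor Y Z) :=
  GRing.isLinear.Build k (Mor X Y) (Mor X Z) *:%R (@postcomp X Y Z g)
    (comp_linearr (X := X) g).

Definition precomp (X Y Z : C) (f : Mor X Y) (g : Mor Y Z) : Mor X Z := g <o> f.
HB.instance Definition _ X Y Z (f : Mor X Y) :=
  GRing.isLinear.Build k (Mor Y Z) (Mor X Z) *:%R (@precomp X Y Z f)
    (comp_linearl (Z := Z) f).

End CategoryTheory.

Record linFunctor (k : comPzRingType) (C D : linCategory k) := LinFunctor {
  fobj :> C -> D;
  fmor : forall X Y, {linear @Mor k C X Y -> Mor (fobj X) (fobj Y)};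
  fmor_id : forall X, fmor X X (idmor X) = idmor (fobj X);
  fmor_comp : forall X Y Z (g : Mor Y Z) (f : Mor X Y),
    fmor X Z (g <o> f) = fmor Y Z g <o> fmor X Y f
}.
Arguments fmor {k C D} F {X Y} : rename.

Definition quasi_inverse (k : comPzRingType) (C D : linCategory k)
    (F : linFunctor C D) (F' : linFunctor D C) : Prop :=
  (exists eta : forall X : C, Mor X (F' (F X)),
     (forall X, is_iso (eta X)) /\
     (forall X Y (f : Mor X Y), eta Y <o> f = fmor F' (fmor F f) <o> eta X)) /\
  (exists eps : forall X : D, Mor (F (F' X)) X,
     (forall X, is_iso (eps X)) /\
     (forall X Y (f : Mor X Y), eps Y <o> fmor F (fmor F' f) = f <o> eps X)).

(* The shift [1] is only required to be an auto-equivalence, with a chosen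
   quasi-inverse [-1]; strict automorphisms are a special case. *)
Record triCategory (k : comPzRingType) := TriCategory {
  tri_cat :> linCategory k;
  tri_additive : additive_category tri_cat;
  shift : linFunctor tri_cat tri_cat;
  unshift : linFunctor tri_cat tri_cat;
  shift_unshift : quasi_inverse shift unshift;
  dist : forall X Y Z : tri_cat, Mor X Y -> Mor Y Z -> Mor Z (shift X) -> Prop;
  TR1_iso : forall (X Y Z X' Y' Z' : tri_cat)
    (f : Mor X Y) (g : Mor Y Z) (h : Mor Z (shift X))
    (f' : Mor X' Y') (g' : Mor Y' Z') (h' : Mor Z' (shift X'))
    (a : Mor X X') (b : Mor Y Y') (c : Mor Z Z'),
    is_iso a -> is_iso b -> is_iso c ->
    b <o> f = f' <o> a -> c <o> g = g' <o> b -> fmor shift a <o> h = h' <o> c ->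
    dist f g h -> dist f' g' h';
  TR1_id : forall X Z : tri_cat, is_zero_object Z ->
    dist (idmor X) (0 : Mor X Z) (0 : Mor Z (shift X));
  TR1_cone : forall (X Y : tri_cat) (f : Mor X Y),
    exists (Z : tri_cat) (g : Mor Y Z) (h : Mor Z (shift X)), dist f g h;
  TR2_rotate : forall (X Y Z : tri_cat)
    (f : Mor X Y) (g : Mor Y Z) (h : Mor Z (shift X)),
    dist f g h <-> dist g h (- fmor shift f);
  TR3_morphism : forall (X Y Z X' Y' Z' : tri_cat)
    (f : Mor X Y) (g : Mor Y Z) (h : Mor Z (shift X))
    (f' : Mor X' Y') (g' : Mor Y' Z') (h' : Mor Z' (shift X'))
    (a : Mor X X') (b : Mor Y Y'),
    dist f g h -> dist f' g' h' -> b <o> f = f' <o> a ->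
    exists c : Mor Z Z', c <o> g = g' <o> b /\ fmor shift a <o> h = h' <o> c;
  TR4_octahedral : forall (X Y Z X' Y' Z' : tri_cat)
    (f : Mor X Y) (i : Mor Y Z') (i' : Mor Z' (shift X))
    (g : Mor Y Z) (j : Mor Z X') (j' : Mor X' (shift Y))
    (m : Mor Z Y') (m' : Mor Y' (shift X)),
    dist f i i' -> dist g j j' -> dist (g <o> f) m m' ->
    exists (u : Mor Z' Y') (v : Mor Y' X'),
      [/\ dist u v (fmor shift i <o> j'),
          u <o> i = m <o> g /\ m' <o> u = i' &
          v <o> m = j /\ j' <o> v = fmor shift f <o> m']
}.
Arguments shift {k t}.
Arguments unshift {k t}.
Arguments dist {k t X Y Z} f g h.

Section Triangulated.
Variables (k : comPzRingType) (T : triCategory k).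

(* X[i]; for i = Negz n, that is i = -(n+1), the chosen quasi-inverse [-1] is
   iterated n+1 times. *)
Definition shiftz (X : T) (i : int) : T :=
  match i with
  | Posz n => iter n shift X
  | Negz n => iter n.+1 unshift X
  end.

(* A full subcategory is encoded by the predicate P of its objects. Closure of P
   under [1] is an equivalence, hence also gives closure under [-1]. *)
Record thick (P : T -> Prop) : Prop := Thick {
  thick_zero : forall Z, is_zero_object Z -> P Z;
  thick_iso : forall X Y (f : Mor X Y), is_iso f -> P X -> P Y;
  thick_shift : forall X, P X <-> P (shift X);
  thick_cone : forall X Y Z (f : Mor X Y) (g : Mor Y Z) (h : Mor Z (shift X)),
    dist f g h -> P X -> P Y -> P Z;
  thick_summand : forall X Y B (i1 : Mor X B) (i2 : Mor Y B)
    (p1 : Mor B X) (p2 : Mor B Y), is_biproduct i1 i2 p1 p2 -> P B -> P X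
}.

Definition classically_generated_by (G : T) : Prop :=
  forall P : T -> Prop, thick P -> P G -> forall X, P X.

End Triangulated.

(* k-linear functors C^op -> k-Mod *)
Record presheaf (k : comPzRingType) (C : linCategory k) := Presheaf {
  pobj :> C -> lmodType k;
  pmap : forall X Y, Mor X Y -> {linear pobj Y -> pobj X};
  pmap_id : forall X (x : pobj X), pmap (idmor X) x = x;
  pmap_comp : forall X Y Z (g : Mor Y Z) (f : Mor X Y) (x : pobj Z),
    pmap (g <o> f) x = pmap f (pmap g x);
  pmap_linear : forall X Y (x : pobj Y), linear (fun f : Mor X Y => pmap f x)
}.
Arguments pmap {k C} F {X Y} f : rename.

Record natTrans (k : comPzRingType) (C : linCategory k) (F F' : presheaf C) :=
  NatTrans {
    ncomp :> forall X, {linear F X -> F' X};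
    ncomp_natural : forall X Y (f : Mor X Y) (x : F Y),
      ncomp X (pmap F f x) = pmap F' f (ncomp Y x)
  }.

Definition nat_iso (k : comPzRingType) (C : linCategory k)
    (F F' : presheaf C) (t : natTrans F F') : Prop :=
  exists t' : natTrans F' F,
    (forall X x, t' X (t X x) = x) /\ (forall X x, t X (t' X x) = x).

Section Presheaves.
Variables (k : comPzRingType) (C : linCategory k).

Section Yoneda.
Variable D : C.
Fact yoneda_id X (x : Mor X D) : precomp (idmor X) x = x.
Proof. exact: compm1. Qed.
Fact yoneda_comp X Y Z (g : Mor Y Z) (f : Mor X Y) (x : Mor Z D) :
  precomp (g <o> f) x = precomp f (precomp g x).
Proof. exact: compmA. Qed.
Fact yoneda_linear X Y (x : Mor Y D) : linear (fun f : Mor X Y => precomp f x).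
Proof. exact: comp_linearr. Qed.

Definition yoneda : presheaf C := @Presheaf k C (fun X => Mor X D)
  (fun X Y f => @precomp k C X Y D f) yoneda_id yoneda_comp yoneda_linear.
End Yoneda.

Section YonedaMap.
Variables (D E : C) (u : Mor D E).
Fact yoneda_map_natural X Y (f : Mor X Y) (x : yoneda D Y) :
  postcomp u (pmap (yoneda D) f x) = pmap (yoneda E) f (postcomp u x).
Proof. exact: compmA. Qed.

Definition yoneda_map : natTrans (yoneda D) (yoneda E) :=
  @NatTrans k C (yoneda D) (yoneda E) (fun X => postcomp u) yoneda_map_natural.
End YonedaMap.

Section Kernel.
Variables (F F' : presheaf C) (t : natTrans F F').

Fact ker_restr_in X Y (f : Mor X Y) (x : linear_ker (t Y)) :
  pmap F f (ker_val x) \in ker_pred (t X).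
Proof.
by rewrite unfold_in ncomp_natural (eqP (valP x)) linear0.
Qed.

Definition ker_restr X Y (f : Mor X Y) (x : linear_ker (t Y)) : linear_ker (t X) :=
  LinearKer (ker_restr_in f x).

Fact ker_restr_linear X Y (f : Mor X Y) : linear (ker_restr f).
Proof. by move=> a x y; apply: val_inj; rewrite /= !linearP. Qed.
HB.instance Definition _ X Y (f : Mor X Y) := GRing.isLinear.Build k
  (linear_ker (t Y)) (linear_ker (t X)) *:%R (ker_restr f) (ker_restr_linear f).

Fact ker_restr_id X (x : linear_ker (t X)) : ker_restr (idmor X) x = x.
Proof. by apply: val_inj; rewrite /= pmap_id. Qed.
Fact ker_restr_comp X Y Z (g : Mor Y Z) (f : Mor X Y) (x : linear_ker (t Z)) :
  ker_restr (g <o> f) x = ker_restr f (ker_restr g x).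
Proof. by apply: val_inj; rewrite /= pmap_comp. Qed.
Fact ker_restr_linearl X Y (x : linear_ker (t Y)) :
  linear (fun f : Mor X Y => ker_restr f x).
Proof. by move=> a f g; apply: val_inj; rewrite /= pmap_linear. Qed.

Definition ker_presheaf : presheaf C := @Presheaf k C (fun X => linear_ker (t X))
  (fun X Y f => ker_restr f) ker_restr_id ker_restr_comp ker_restr_linearl.
End Kernel.

Section Colimit.
Variables (F : nat -> presheaf C) (t : forall i, natTrans (F i) (F i.+1)).

Definition colim_obj (X : C) : lmodType k :=
  lin_colim (fun i => t i X).

Definition colim_restr X Y (f : Mor X Y) : {linear colim_obj Y -> colim_obj X} :=
  lin_colim_map (f := fun i => t i Y) (g := fun i => t i X)
    (u := fun i => pmap (F i) f)
    (fun i x => esym (ncomp_natural (t i) f x)).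

Fact colim_restr_id X (x : colim_obj X) : colim_restr (idmor X) x = x.
Proof.
have [i [y ->]] := lin_colim_surj x.
by rewrite /= lin_colim_map_in pmap_id.
Qed.
Fact colim_restr_comp X Y Z (g : Mor Y Z) (f : Mor X Y) (x : colim_obj Z) :
  colim_restr (g <o> f) x = colim_restr f (colim_restr g x).
Proof.
have [i [y ->]] := lin_colim_surj x.
by rewrite /= !lin_colim_map_in pmap_comp.
Qed.
Fact colim_restr_linear X Y (x : colim_obj Y) :
  linear (fun f : Mor X Y => colim_restr f x).
Proof.
move=> a f g; have [i [y ->]] := lin_colim_surj x.
by rewrite /= !lin_colim_map_in pmap_linear linearP.
Qed.

Definition colim_presheaf : presheaf C := @Presheaf k C colim_obj
  colim_restr colim_restr_id colim_restr_comp colim_restr_linear.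
End Colimit.

End Presheaves.

Section LocallyFinite.
Variables (k : comPzRingType) (T : triCategory k).

Definition cohomological (H : presheaf T) : Prop :=
  forall (X Y Z : T) (f : Mor X Y) (g : Mor Y Z) (h : Mor Z (shift X)),
    dist f g h ->
    forall y : H Y, pmap H f y = 0 <-> exists z : H Z, pmap H g z = y.

Definition locally_finitely_generated (H : presheaf T) : Prop :=
  forall X : T, exists (D : T) (alpha : natTrans (yoneda D) H),
    forall (i : int) (y : H (shiftz X i)),
      exists x : yoneda D (shiftz X i), alpha (shiftz X i) x = y.

Definition locally_finitely_presented (H : presheaf T) : Prop :=
  locally_finitely_generated H /\
  forall (E : T) (beta : natTrans (yoneda E) H),
    locally_finitely_generated (ker_presheaf beta).

Definition almost_constant_on (I : T -> Prop)
    (A : nat -> T) (f : forall i, Mor (A i) (A i.+1)) : Prop :=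
  forall X : T, I X ->
    @almost_constant (fun i => Mor X (A i)) (fun i => @postcomp k T X _ _ (f i)).

End LocallyFinite.

(* Main.v *)
From HB Require Import structures.
From mathcomp Require Import all_boot all_order all_algebra.
From mathcomp Require Import generic_quotient ring_quotient.
From mathcomp Require Import boolp.
Require Import Defs.

Set Implicit Arguments.
Unset Strict Implicit.
Unset Printing Implicit Defensive.

Import GRing.Theory.
Local Open Scope ring_scope.
Local Open Scope quotient_scope.

(** By the Yoneda lemma, a map from a system [A 0 -> A 1 -> ...] of
    representable functors to [H] is a sequence of elements [a i] of [H (A i)]
    compatible with the transition maps. Both directions of the equivalence
    compare such a system with [H] through one quantitative condition,
    [approximates N X]: every element of [H X] comes from [Hom(X, A i)] as soon
    as [i >= N], and a morphism [X -> A i] that gives 0 in [H X] dies after [N]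
    further transitions. Almost constancy at [X] together with
    [colim Hom(X, A i) = H X] amounts to this with [N = 1] (and surjectivity also
    for [i = 0]).

    The condition passes to retracts, and it passes to cones when the bound is
    doubled: this is the four lemma, in which every recourse to an approximate
    kernel costs [N] transitions ([approximates_cone]). Hence, if it holds with
    one bound at all shifts [G[i]] of a classical generator, then every object [X]
    has a bound valid at all [X[i]] ([uniform_generation], [approximates_everywhere]). The
    bound has to be uniform in the shift for the induction on the generation of
    [X] to work, and also for the conclusion, since local finite generation asks
    for one object that serves all [X[i]].

    If [H] is the colimit of an almost constant system, this gives local finite
    presentation ([approximates_lfp]): [A N] generates [H] at all [X[i]], and a
    map from [Hom(-, E)] to [H] is represented by some [b : E -> A M], so that its
    kernel at the [X[i]] consists of the morphisms killed by the composite
    [E -> A M -> A (M + N)]. The fibre of this composite generates that kernel.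

    Conversely, if [H] is locally finitely presented, choose [A 0] generating [H]
    at all [G[i]], then [D -> A 0] generating the kernel of [Hom(-, A 0) -> H] at
    all [G[i]], and let [A 1] be the cone of [D -> A 0] ([cover_next]). The map to
    [H] extends to [A 1] because [H] is cohomological, and the kernel of
    [Hom(G[i], A 0) -> H (G[i])] is now killed in one step. Iterating gives an
    almost constant system whose colimit maps isomorphically to [H] at the [G[i]],
    hence everywhere ([colim_ev_iso]). *)

(** * Linear categories and presheaves *)

Section Linear.
Variables (k : comPzRingType) (C : linCategory k).

Lemma comp0m (X Y Z : C) (f : Mor X Y) : (0 : Mor Y Z) <o> f = 0.
Proof. exact: (linear0 (precomp f)). Qed.

Lemma compm0 (X Y Z : C) (g : Mor Y Z) : g <o> (0 : Mor X Y) = 0.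
Proof. exact: (linear0 (postcomp g)). Qed.

Lemma compNm (X Y Z : C) (g : Mor Y Z) (f : Mor X Y) : (- g) <o> f = - (g <o> f).
Proof. exact: (linearN (precomp f)). Qed.

Lemma compmN (X Y Z : C) (g : Mor Y Z) (f : Mor X Y) : g <o> (- f) = - (g <o> f).
Proof. exact: (linearN (postcomp g)). Qed.

Lemma compmB (X Y Z : C) (g : Mor Y Z) (f f' : Mor X Y) :
  g <o> (f - f') = g <o> f - g <o> f'.
Proof. exact: (linearB (postcomp g)). Qed.

(** The map of presheaves attached to an element by the Yoneda lemma; it is also
    what makes [pmap] linear in its morphism argument available to rewriting. *)
Section YonedaLemma.
Variables (H : presheaf C) (A : C) (a : H A).

Definition yoneda_ev (X : C) (x : yoneda A X) : H X := pmap H x a.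

Fact yoneda_ev_linear X : linear (@yoneda_ev X).
Proof. exact: (pmap_linear (p := H)). Qed.
HB.instance Definition _ X := GRing.isLinear.Build k (yoneda A X) (H X) *:%R
  (@yoneda_ev X) (@yoneda_ev_linear X).

Fact yoneda_ev_natural X Y (f : Mor X Y) (x : yoneda A Y) :
  yoneda_ev (pmap (yoneda A) f x) = pmap H f (yoneda_ev x).
Proof. exact: pmap_comp. Qed.

Definition yoneda_nat : natTrans (yoneda A) H :=
  @NatTrans k C (yoneda A) H (fun X => @yoneda_ev X) yoneda_ev_natural.
End YonedaLemma.

Lemma pmap0 (H : presheaf C) (X A : C) (a : H A) : pmap H (0 : Mor X A) a = 0.
Proof. exact: (linear0 (@yoneda_ev H A a X)). Qed.

Lemma pmapB (H : presheaf C) (X A : C) (f g : Mor X A) (a : H A) :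
  pmap H (f - g) a = pmap H f a - pmap H g a.
Proof. exact: (linearB (@yoneda_ev H A a X)). Qed.

Lemma pmapD (H : presheaf C) (X A : C) (f g : Mor X A) (a : H A) :
  pmap H (f + g) a = pmap H f a + pmap H g a.
Proof. exact: (linearD (@yoneda_ev H A a X)). Qed.

Lemma yoneda_natE (H : presheaf C) (D : C) (t : natTrans (yoneda D) H)
    (X : C) (x : Mor X D) :
  t X x = pmap H x (t D (idmor D)).
Proof. by rewrite -ncomp_natural /= /precomp comp1m. Qed.

Section Inverse.
Variables (F F' : presheaf C) (t : natTrans F F').
Hypothesis t_inj : forall X (x : F X), t X x = 0 -> x = 0.
Hypothesis t_surj : forall X (y : F' X), exists x, t X x = y.

Definition nat_inv X (y : F' X) : F X := projT1 (cid (t_surj y)).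

Lemma nat_invK X (y : F' X) : t X (nat_inv y) = y.
Proof. exact: projT2 (cid (t_surj y)). Qed.

Lemma nat_cancel X (x y : F X) : t X x = t X y -> x = y.
Proof. by move=> xy; apply/subr0_eq/t_inj; rewrite linearB xy subrr. Qed.

Fact nat_inv_linear X : linear (@nat_inv X).
Proof. by move=> a x y; apply: nat_cancel; rewrite linearP !nat_invK. Qed.
HB.instance Definition _ X := GRing.isLinear.Build k (F' X) (F X) *:%R
  (@nat_inv X) (@nat_inv_linear X).

Fact nat_inv_natural X Y (f : Mor X Y) (y : F' Y) :
  nat_inv (pmap F' f y) = pmap F f (nat_inv y).
Proof. by apply: nat_cancel; rewrite ncomp_natural !nat_invK. Qed.

Lemma nat_iso_pointwise : nat_iso t.
Proof.
exists (@NatTrans k C F' F (fun X => @nat_inv X) nat_inv_natural).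
by split=> X x /=; [apply: nat_cancel |]; rewrite nat_invK.
Qed.
End Inverse.

Definition retract (X Y : C) : Prop :=
  exists (i : Mor X Y) (p : Mor Y X), p <o> i = idmor X.

Lemma iso_retract (X Y : C) (f : Mor X Y) : is_iso f -> retract X Y.
Proof. by case=> g [gf _]; exists f, g. Qed.

Lemma iso_retract_inv (X Y : C) (f : Mor X Y) : is_iso f -> retract Y X.
Proof. by case=> g [_ fg]; exists g, f. Qed.

Lemma retract_trans (X Y Z : C) : retract X Y -> retract Y Z -> retract X Z.
Proof.
move=> [i [p pi]] [j [q qj]]; exists (j <o> i), (p <o> q).
by rewrite compmA -(compmA p) qj compm1.
Qed.

Lemma is_iso_id (X : C) : is_iso (idmor X).
Proof. by exists (idmor X); rewrite comp1m. Qed.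

End Linear.

Section Functors.
Variables (k : comPzRingType) (C D : linCategory k) (F : linFunctor C D).

Lemma fmor_retract X Y : retract X Y -> retract (F X) (F Y).
Proof.
by move=> [i [p pi]]; exists (fmor F i), (fmor F p); rewrite -fmor_comp pi fmor_id.
Qed.

Variable F' : linFunctor D C.
Hypothesis FF' : quasi_inverse F F'.

Lemma equiv_faithful X Y (f g : Mor X Y) : fmor F f = fmor F g -> f = g.
Proof.
move=> Ffg; case: FF' => [[eta [eta_iso etaN]] _].
have [e [eE _]] := eta_iso Y.
by rewrite -[f]comp1m -[g]comp1m -eE -!compmA !etaN Ffg.
Qed.

Lemma equiv_faithful_inv X Y (f g : Mor X Y) : fmor F' f = fmor F' g -> f = g.
Proof.
move=> Ffg; case: FF' => [_ [eps [eps_iso epsN]]].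
have [e [_ eE]] := eps_iso X.
by rewrite -[f]compm1 -[g]compm1 -eE !compmA -!epsN Ffg.
Qed.

(** The usual argument: the preimage of [m] under [F] is found by transporting
    [F' m] along the unit, and it is correct because [F'] is faithful. *)
Lemma equiv_full X Y (m : Mor (F X) (F Y)) : exists f, fmor F f = m.
Proof.
have [[eta [eta_iso etaN]] _] := FF'.
have [e [_ Ee]] := eta_iso Y; have [d [_ Ed]] := eta_iso X.
exists (e <o> (fmor F' m <o> eta X)); apply: equiv_faithful_inv.
rewrite -[LHS]compm1 -Ed compmA -etaN compmA Ee comp1m.
by rewrite -compmA Ed compm1.
Qed.

End Functors.

(** * Triangles *)

Section Triangles.
Variables (k : comPzRingType) (T : triCategory k).

(** Its rotation is the triangle on the identity of [A]. *)
Lemma dist_zero_left (A Z0 : T) : is_zero_object Z0 ->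
  dist (0 : Mor Z0 A) (idmor A) (0 : Mor A (shift Z0)).
Proof.
move=> zZ; apply/TR2_rotate; rewrite linear0 oppr0; apply: TR1_id.
have id0 : idmor (shift Z0) = 0 :> Mor (shift Z0) (shift Z0).
  by rewrite -fmor_id (proj1 (zZ Z0) (idmor Z0) 0) linear0.
move=> X; split=> f g.
  by rewrite -[f]comp1m -[g]comp1m id0 !comp0m.
by rewrite -[f]compm1 -[g]compm1 id0 !compm0.
Qed.

Section OneTriangle.
Variables (X Y Z : T) (f : Mor X Y) (g : Mor Y Z) (h : Mor Z (shift X)).
Hypothesis fgh : dist f g h.

(** Compare with the triangle on the identity of [X], through [(idmor X, f)]. *)
Lemma dist_comp0 : g <o> f = 0.
Proof.
have [[Z0 zZ] _] := tri_additive T.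
have [|c [<- _]] := TR3_morphism (TR1_id X zZ) fgh (a := idmor X) (b := f) => //.
by rewrite compm0.
Qed.

(** Compare with the triangle [0 -> A -> A], through [(0, y)]. *)
Lemma dist_factor_cone (A : T) (y : Mor Y A) : y <o> f = 0 -> exists z, z <o> g = y.
Proof.
move=> yf; have [[Z0 zZ] _] := tri_additive T.
have [|c [cg _]] := TR3_morphism fgh (dist_zero_left A zZ) (a := 0) (b := y).
  by rewrite yf comp0m.
by exists c; rewrite cg comp1m.
Qed.

(** The comparison axiom produces third components only, so the triangle on the
    identity of [W] and the given one are rotated first; the component obtained is
    then a morphism [shift W -> shift X], which desuspends because the shift is
    full and faithful. *)
Lemma dist_factor_fibre (W : T) (x : Mor W Y) : g <o> x = 0 -> exists w, f <o> w = x.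
Proof.
move=> gx; have [[Z0 zZ] _] := tri_additive T.
have /TR2_rotate idW := TR1_id W zZ; have /TR2_rotate ghf := fgh.
have [|c [_ cE]] := TR3_morphism idW ghf (a := x) (b := 0).
  by rewrite gx comp0m.
have [w wE] := equiv_full (shift_unshift T) c.
exists w; apply: (equiv_faithful (shift_unshift T)).
move: cE; rewrite fmor_id compmN compm1 compNm -wE -fmor_comp.
by move/oppr_inj.
Qed.

(** Only the existence of the rotated triangle matters, so the sign and the
    identification of [Z] with [shift (unshift Z)] are absorbed in its maps. *)
Lemma dist_rotate_back :
  exists (w : Mor (unshift Z) X) (g' : Mor Y (shift (unshift Z))), dist w f g'.
Proof.
have [_ [eps [eps_iso _]]] := shift_unshift T; have [e [eE Ee]] := eps_iso Z.
have [w wE] := equiv_full (shift_unshift T) (- (h <o> eps Z)).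
exists w, (e <o> g); apply/TR2_rotate; rewrite wE opprK.
have e_iso : is_iso e by exists (eps Z).
apply: (TR1_iso (is_iso_id X) (is_iso_id Y) e_iso) fgh.
- by rewrite comp1m compm1.
- by rewrite compm1.
- by rewrite fmor_id comp1m -compmA Ee compm1.
Qed.

End OneTriangle.

(** Rotating three times shifts all objects, with signs on the maps that are
    irrelevant here; likewise for rotating back in [dist_unshift]. *)
Lemma dist_shift (X Y Z : T) (f : Mor X Y) (g : Mor Y Z) (h : Mor Z (shift X)) :
  dist f g h -> exists (f' : Mor (shift X) (shift Y)) (g' : Mor (shift Y) (shift Z))
    (h' : Mor (shift Z) (shift (shift X))), dist f' g' h'.
Proof.
by move=> /TR2_rotate /TR2_rotate /TR2_rotate d; do 3! eexists; exact: d.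
Qed.

Lemma dist_unshift (X Y Z : T) (f : Mor X Y) (g : Mor Y Z) (h : Mor Z (shift X)) :
  dist f g h -> exists (f' : Mor (unshift X) (unshift Y))
    (g' : Mor (unshift Y) (unshift Z))
    (h' : Mor (unshift Z) (shift (unshift X))), dist f' g' h'.
Proof.
move=> /dist_rotate_back[w [g' /dist_rotate_back[w' [g'' d]]]].
by have [w'' [g3 d']] := dist_rotate_back d; exists w'', w', g3.
Qed.

(** * Generation with uniform bounds *)

(** The objects isomorphic to some [X[i]], presented without integers: chosen
    quasi-inverses make [shiftz] compatible with addition of exponents only up to
    isomorphism, and this closure absorbs these isomorphisms. *)
Inductive orbit (X : T) : T -> Prop :=
| orbit_refl : orbit X X
| orbit_shift W : orbit X W -> orbit X (shift W)
| orbit_unshift W : orbit X W -> orbit X (unshift W)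
| orbit_iso V W (f : Mor V W) : is_iso f -> orbit X V -> orbit X W.

Lemma orbit_trans X Y W : orbit X Y -> orbit Y W -> orbit X W.
Proof.
move=> XY; elim=> {W} // => [W _ | W _ | V W f fi _]; first exact: orbit_shift.
  exact: orbit_unshift.
exact: (orbit_iso fi).
Qed.

Lemma orbit_shiftz X i : orbit X (shiftz X i).
Proof.
have iter_orbit F n : (forall W, orbit X W -> orbit X (F W)) -> orbit X (iter n F X).
  by move=> XF; elim: n => [|n IHn]; [exact: orbit_refl | exact: XF].
case: i => n; first exact: (iter_orbit shift n (@orbit_shift X)).
exact: (iter_orbit unshift n.+1 (@orbit_unshift X)).
Qed.

Lemma shift_orbit X : orbit (shift X) X.
Proof.
have [[eta [eta_iso _]] _] := shift_unshift T; have [e [eE Ee]] := eta_iso X.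
apply: (@orbit_iso _ _ _ e); first by exists (eta X).
exact/orbit_unshift/orbit_refl.
Qed.

(** Retracts rather than isomorphisms: this is all that is used of the [shiftz],
    and functors visibly preserve it. *)
Lemma orbit_retract_shiftz X W : orbit X W -> exists i, retract W (shiftz X i).
Proof.
have [[eta [eta_iso _]] [eps [eps_iso _]]] := shift_unshift T.
elim=> {W} [|W _ [i Wi]|W _ [i Wi]|V W f f_iso _ [i Vi]].
- by exists 0%:Z; exists (idmor X), (idmor X); rewrite comp1m.
- have {Wi} := fmor_retract (@shift k T) Wi; case: i => [n|[|n]] /= Wi.
  + by exists (Posz n.+1).
  + by exists (Posz 0); apply: retract_trans Wi _; apply: iso_retract (eps_iso _).
  + by exists (Negz n); apply: retract_trans Wi _; apply: iso_retract (eps_iso _).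
- have {Wi} := fmor_retract (@unshift k T) Wi; case: i => [[|n]|n] /= Wi.
  + by exists (Negz 0).
  + exists (Posz n); apply: retract_trans Wi _.
    exact: iso_retract_inv (eta_iso _).
  + by exists (Negz n.+1).
- by exists i; apply: retract_trans Vi; apply: iso_retract_inv f_iso.
Qed.

Lemma retract_orbit X B W : retract X B -> orbit X W ->
  exists2 V, orbit B V & retract W V.
Proof.
move=> XB; elim=> {W} [|W _ [V BV WV]|W _ [V BV WV]|V' W f fi _ [V BV WV]].
- by exists B => //; exact: orbit_refl.
- by exists (shift V); [exact: orbit_shift | exact: fmor_retract].
- by exists (unshift V); [exact: orbit_unshift | exact: fmor_retract].
- by exists V => //; apply: retract_trans WV; apply: iso_retract_inv fi.
Qed.

Lemma orbit_cone (X Y Z W : T) (f : Mor X Y) (g : Mor Y Z) (h : Mor Z (shift X)) :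
  dist f g h -> orbit Z W ->
  exists (X' Y' : T) (f' : Mor X' Y') (g' : Mor Y' W) (h' : Mor W (shift X')),
    [/\ orbit X X', orbit Y Y' & dist f' g' h'].
Proof.
move=> fgh; elim=> {W}.
- by exists X, Y, f, g, h; split=> //; exact: orbit_refl.
- move=> W _ [X' [Y' [f' [g' [h' [oX oY]]]]]].
  move=> /dist_shift[f1 [g1 [h1 d]]]; exists (shift X'), (shift Y'), f1, g1, h1.
  by split=> //; exact: orbit_shift.
- move=> W _ [X' [Y' [f' [g' [h' [oX oY]]]]]].
  move=> /dist_unshift[f1 [g1 [h1 d]]]; exists (unshift X'), (unshift Y'), f1, g1, h1.
  by split=> //; exact: orbit_unshift.
- move=> V W c c_iso _ [X' [Y' [f' [g' [h' [oX oY d]]]]]].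
  have [c' [cc c'c]] := c_iso.
  exists X', Y', f', (c <o> g'), (h' <o> c'); split=> //.
  apply: (TR1_iso (is_iso_id X') (is_iso_id Y') c_iso) d.
  + by rewrite comp1m compm1.
  + by rewrite compm1.
  + by rewrite fmor_id comp1m -compmA cc compm1.
Qed.

(** Thick induction on the statement that some bound is valid on the whole
    orbit. Since an orbit consists of retracts of the [shiftz], a hypothesis on
    the [shiftz G i] extends to the orbit of [G], and every triangle ending in the
    orbit of [Z] comes with first two vertices in the orbits of [X] and [Y]. *)
Theorem uniform_generation (G : T) (P : nat -> T -> Prop) :
    classically_generated_by G ->
    (forall M N X, (M <= N)%N -> P M X -> P N X) ->
    (forall N X Y, retract X Y -> P N Y -> P N X) ->
    (forall N X Y Z (f : Mor X Y) (g : Mor Y Z) (h : Mor Z (shift X)), dist f g h ->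
       P N X -> P N Y -> P N (shift X) -> P N (shift Y) -> P (N + N)%N Z) ->
    (exists N, forall i, P N (shiftz G i)) ->
  forall X, exists N, forall i, P N (shiftz X i).
Proof.
move=> HG Pmono Pretract Pcone [N0 PG] X.
suff [N PN] : exists N, forall W, orbit X W -> P N W.
  by exists N => i; apply: PN; exact: orbit_shiftz.
have PoG W : orbit G W -> P N0 W.
  by move=> /orbit_retract_shiftz[i]; move/Pretract; apply.
apply: (HG (fun X => exists N, forall W, orbit X W -> P N W)); last by exists N0.
have transfer V V' : orbit V V' -> (exists N, forall W, orbit V W -> P N W) ->
    exists N, forall W, orbit V' W -> P N W.
  by move=> VV' [N PN]; exists N => W V'W; apply: PN; exact: orbit_trans V'W.
split.
- move=> Z zZ; exists N0 => W ZW.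
  (* A zero object is a retract of anything. *)
  have ZG : retract Z G.
    by exists 0, 0; rewrite comp0m; apply: (proj1 (zZ Z)).
  by have [V /PoG GV /Pretract] := retract_orbit ZG ZW; apply.
- move=> V V' f f_iso; apply: transfer; apply: orbit_iso f_iso _; exact: orbit_refl.
- move=> V; split; apply: transfer; last exact: shift_orbit.
  exact/orbit_shift/orbit_refl.
- move=> V V' Z f g h d [M PM] [N PN]; exists (maxn M N + maxn M N)%N => W ZW.
  have [X' [Y' [f' [g' [h' [oX oY d']]]]]] := orbit_cone d ZW.
  apply: Pcone d' _ _ _ _.
  + by apply: Pmono (PM _ oX); rewrite leq_maxl.
  + by apply: Pmono (PN _ oY); rewrite leq_maxr.
  + by apply: Pmono (PM _ (orbit_shift oX)); rewrite leq_maxl.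
  + by apply: Pmono (PN _ (orbit_shift oY)); rewrite leq_maxr.
- move=> V V' B i1 i2 p1 p2 [p1i1 _ _ _ _] [N PN]; exists N => W VW.
  have VB : retract V B by exists i1, p1.
  by have [U /PN BU /Pretract] := retract_orbit VB VW; apply.
Qed.

End Triangles.

(** * Systems of representable functors over a cohomological functor *)

Section System.
Variables (k : comPzRingType) (T : triCategory k) (H : presheaf T).
Hypothesis Hcoh : cohomological H.
Variables (A : nat -> T) (f : forall i, Mor (A i) (A i.+1)).
Variable a : forall i, H (A i).
Hypothesis fa : forall i, pmap H (f i) (a i.+1) = a i.

(** The transition map is the image of the identity in the system
    [Hom(A i, A j)]; indexing it by both ends avoids casts between [A (i + n)]
    and [A (n + i)]. For [j < i] the value is junk, namely 0. *)
Definition trans i j : Mor (A i) (A j) :=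
  @push_seq (fun j => Mor (A i) (A j)) (fun j => @postcomp k T (A i) _ _ (f j))
    i (idmor (A i)) j.

Lemma trans_id i : trans i i = idmor (A i).
Proof. exact: push_seq_id. Qed.

Lemma transS i j : (i <= j)%N -> trans i j.+1 = f j <o> trans i j.
Proof. by rewrite /trans /= => ->. Qed.

Lemma trans_step i : trans i i.+1 = f i.
Proof. by rewrite transS // trans_id compm1. Qed.

Lemma trans_comp i j l : (i <= j)%N -> (j <= l)%N ->
  trans j l <o> trans i j = trans i l.
Proof.
move=> ij; elim: l => [|l IHl].
  by rewrite leqn0 => /eqP j0; subst j; rewrite trans_id comp1m.
rewrite leq_eqVlt => /predU1P[j_l|]; first by subst j; rewrite trans_id comp1m.
rewrite ltnS => jl; rewrite transS // -compmA IHl // transS //.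
exact: leq_trans jl.
Qed.

Lemma pmap_trans i j : (i <= j)%N -> pmap H (trans i j) (a j) = a i.
Proof.
elim: j => [|j IHj].
  by rewrite leqn0 => /eqP i0; subst i; rewrite trans_id pmap_id.
rewrite leq_eqVlt => /predU1P[i_j|]; first by subst i; rewrite trans_id pmap_id.
by rewrite ltnS => ij; rewrite transS // pmap_comp fa IHj.
Qed.

Definition approximates (N : nat) (X : T) : Prop :=
  (forall i, (N <= i)%N ->
     forall y : H X, exists x : Mor X (A i), pmap H x (a i) = y) /\
  (forall i j, (i + N <= j)%N ->
     forall x : Mor X (A i), pmap H x (a i) = 0 -> trans i j <o> x = 0).

Lemma approximates_mono M N X :
  (M <= N)%N -> approximates M X -> approximates N X.
Proof.
move=> MN [surj ker]; split=> [i Ni | i j ij]; first exact/surj/(leq_trans MN).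
by apply: ker; apply: leq_trans ij; rewrite leq_add2l.
Qed.

Lemma approximates_retract N X Y : retract X Y -> approximates N Y -> approximates N X.
Proof.
move=> [i [p pi]] [surj ker]; split=> [n Nn y | n m nm x x0].
  have [x xE] := surj n Nn (pmap H p y); exists (x <o> i).
  by rewrite pmap_comp xE -pmap_comp pi pmap_id.
rewrite -[x]compm1 -pi !compmA -(compmA (trans n m)) ker ?comp0m //.
by rewrite pmap_comp x0 linear0.
Qed.

(** Four lemma with bounds, along the exact rows of the triangle: for
    surjectivity [H Y[1] -> H X[1] -> H Z -> H Y -> H X] truncated to the last
    four terms, for the kernel truncated to the first four. Each recourse to the
    kernel condition costs [N] transitions. *)
Lemma approximates_cone N X Y Z (u : Mor X Y) (v : Mor Y Z) (w : Mor Z (shift X)) :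
  dist u v w -> approximates N X -> approximates N Y ->
  approximates N (shift X) -> approximates N (shift Y) -> approximates (N + N)%N Z.
Proof.
move=> uvw [_ kerX] [surjY kerY] [surjX1 kerX1] [surjY1 _].
have /TR2_rotate vwu := uvw; have /TR2_rotate wuv := vwu.
split=> [i NNi z | i j ij z z0].
  (* Lift the image of z in H Y to level N; at level N + N, hence at level i, the
     lift vanishes on X and so extends to Z. *)
  have Ni : (N <= i)%N by apply: leq_trans NNi; rewrite leq_addr.
  have [y yE] := surjY N (leqnn N) (pmap H v z).
  have yu0 : trans N i <o> (y <o> u) = 0.
    apply: kerX => //; rewrite pmap_comp yE.
    by apply/(Hcoh uvw); exists z.
  have [z' z'E] : exists z', z' <o> v = trans N i <o> y.
    by apply: (dist_factor_cone uvw); rewrite -compmA.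
  (* The error made by z' vanishes on Y, so it comes from X[1], where it lifts. *)
  have /(Hcoh vwu)[x1 x1E] : pmap H v (z - pmap H z' (a i)) = 0.
    rewrite linearB -yE -(pmap_comp z' v) z'E pmap_comp pmap_trans //.
    by rewrite subrr.
  have [x xE] := surjX1 i Ni x1.
  exists (z' + x <o> w).
  by rewrite pmapD pmap_comp xE x1E addrC subrK.
(* After N transitions z vanishes on Y and so factors through w by some x. The
   image of x in H X[1] comes from H Y[1]; correcting x by a lift y of that
   element, which does not change x o w, makes x vanish after N more. *)
pose m := (i + N)%N.
have im : (i <= m)%N by rewrite leq_addr.
have mNj : (m + N <= j)%N by rewrite -addnA.
have mj : (m <= j)%N by apply: leq_trans mNj; rewrite leq_addr.
have zv0 : trans i m <o> (z <o> v) = 0.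
  by apply: kerY => //; rewrite pmap_comp z0 linear0.
have [x xE] : exists x, x <o> w = trans i m <o> z.
  by apply: (dist_factor_cone vwu); rewrite -compmA.
have /(Hcoh wuv)[y1 y1E] : pmap H w (pmap H x (a m)) = 0.
  by rewrite -pmap_comp xE pmap_comp pmap_trans.
have [y yE] := surjY1 m (leq_addl _ _) y1.
have /(kerX1 _ _ mNj) : pmap H (x - y <o> (- fmor shift u)) (a m) = 0.
  by rewrite pmapB pmap_comp yE y1E subrr.
rewrite compmB => /subr0_eq xy.
rewrite -(trans_comp im mj) -compmA -xE compmA xy -!compmA (dist_comp0 wuv).
by rewrite !compm0.
Qed.

Lemma approximates_everywhere (G : T) : classically_generated_by G ->
    (exists N, forall i, approximates N (shiftz G i)) ->
  forall X, exists N, forall i, approximates N (shiftz X i).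
Proof.
move=> HG; apply: uniform_generation HG _ _ _.
- exact: approximates_mono.
- exact: approximates_retract.
- by move=> N X Y Z u v w; apply: approximates_cone.
Qed.

(** Over the shifts of [X], the kernel of [beta] consists of the morphisms to [E]
    killed by a single [c : E -> A (M + N)]; the fibre of [c] generates it. *)
Lemma approximates_lfp : (forall X, exists N, forall i, approximates N (shiftz X i)) ->
  locally_finitely_presented H.
Proof.
move=> HP; split=> [X | E beta X].
  have [N PN] := HP X; exists (A N), (yoneda_nat (a N)) => i y.
  exact: (proj1 (PN i) N (leqnn N) y).
have [M /(_ (Posz 0))[surjE _]] := HP E.
have [b bE] := surjE M (leqnn M) (beta E (idmor E)).
have [N PN] := HP X.
have betaE W (x : Mor W E) : beta W x = pmap H (b <o> x) (a M).
  by rewrite yoneda_natE -bE pmap_comp.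
pose c := trans M (M + N) <o> b.
have [D [d [d' dcd]]] : exists D (d : Mor D E) d', dist d c d'.
  have [Z [g [h d]]] := TR1_cone c.
  by have [w [g' d']] := dist_rotate_back d; exists (unshift Z), w, g'.
have d_ker : (d : yoneda E D) \in ker_pred (beta D).
  rewrite unfold_in betaE -(pmap_trans (leq_addr N M)) -pmap_comp compmA.
  by rewrite (dist_comp0 dcd) pmap0.
exists D, (yoneda_nat (H := ker_presheaf beta) (LinearKer d_ker)) => i [y y_ker].
have [x xE] : exists x, d <o> x = y.
  apply: (dist_factor_fibre dcd); rewrite -compmA.
  by apply: (proj2 (PN i)) => //; rewrite -betaE; exact/eqP.
by exists x; apply: val_inj.
Qed.

Section ColimitMap.

Local Notation F := (colim_presheaf (fun i => yoneda_map (f i))).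

Fact colim_ev_exists (X : T) : exists h : F X -> H X,
  linear h /\ forall i (x : Mor X (A i)),
    h (lin_colim_in (fun i => yoneda_map (f i) X) x) = pmap H x (a i).
Proof.
have [|h [[hL hE] _]] := @lin_colim_universal k (fun i => yoneda (A i) X)
  (fun i => yoneda_map (f i) X) (H X) (fun i => @yoneda_ev k T H (A i) (a i) X).
  by move=> i x; rewrite /= /yoneda_ev pmap_comp fa.
by exists h.
Qed.

Definition colim_ev X : F X -> H X := projT1 (cid (colim_ev_exists X)).

Lemma colim_evE X i (x : Mor X (A i)) :
  colim_ev (lin_colim_in (fun i => yoneda_map (f i) X) x) = pmap H x (a i).
Proof. exact: (proj2 (projT2 (cid (colim_ev_exists X)))). Qed.

Fact colim_ev_linear X : linear (@colim_ev X).
Proof. exact: (proj1 (projT2 (cid (colim_ev_exists X)))). Qed.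
HB.instance Definition _ X := GRing.isLinear.Build k (F X) (H X) *:%R
  (@colim_ev X) (@colim_ev_linear X).

Fact colim_ev_natural X Y (g : Mor X Y) (c : F Y) :
  colim_ev (pmap F g c) = pmap H g (colim_ev c).
Proof.
have [i [x ->]] := lin_colim_surj c.
by rewrite /= lin_colim_map_in !colim_evE /= /precomp pmap_comp.
Qed.

Definition colim_nat : natTrans F H :=
  @NatTrans k T F H (fun X => @colim_ev X) colim_ev_natural.

Lemma lin_colim_in_trans X i j (x : Mor X (A i)) : (i <= j)%N ->
  lin_colim_in (fun i => yoneda_map (f i) X) (trans i j <o> x) =
  lin_colim_in (fun i => yoneda_map (f i) X) x.
Proof.
elim: j => [|j IHj].
  by rewrite leqn0 => /eqP i0; subst i; rewrite trans_id comp1m.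
rewrite leq_eqVlt => /predU1P[i_j|]; first by subst i; rewrite trans_id comp1m.
rewrite ltnS => ij; rewrite transS // -compmA -IHj //.
exact: (lin_colim_in_f (fun i => yoneda_map (f i) X)).
Qed.

Lemma colim_ev_inj N X (c : F X) : approximates N X -> colim_ev c = 0 -> c = 0.
Proof.
move=> [_ ker]; have [i [x ->]] := lin_colim_surj c.
rewrite colim_evE => /(ker _ _ (leqnn _)) x0.
by rewrite -(lin_colim_in_trans x (leq_addr N i)) x0 linear0.
Qed.

Lemma colim_ev_iso : (forall X, exists N, approximates N X) -> nat_iso colim_nat.
Proof.
move=> HP; apply: nat_iso_pointwise => X.
  by have [N PN] := HP X; move=> c; apply: colim_ev_inj PN.
move=> y; have [N [/(_ N (leqnn N) y)[x xE] _]] := HP X.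
by exists (lin_colim_in (fun i => yoneda_map (f i) X) x); rewrite /= colim_evE.
Qed.

End ColimitMap.

End System.

(** * Almost constant systems *)

(** Replaces the isomorphism [V i / ker f i = colim] by two conditions on
    elements. The reverse of the second one always holds. *)
Lemma almost_constantP (V : nat -> zmodType) (f : forall i, {additive V i -> V i.+1}) :
  almost_constant f <-> forall i,
    (forall c, exists x : V i, seq_colim_in f x = c) /\
    (forall x : V i, seq_colim_in f x = 0 -> f i x = 0).
Proof.
split=> [fac i | fac i].
  have [phi [[psi phiK psiK] phiE]] := fac i; split=> [c | x x0].
    by exists (repr (psi c)); rewrite -phiE reprK psiK.
  have : \pi_(Quotient.quot (additive_ker (f i))) x = 0.
    by apply: (can_inj phiK); rewrite phiE x0 raddf0.
  rewrite -(raddf0 \pi_(Quotient.quot (additive_ker (f i)))).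
  by move=> /eqP; rewrite -Quotient.idealrBE subr0 => /eqP.
have [surj ker] := fac i.
pose Q := Quotient.quot (additive_ker (f i)).
have piE (x y : V i) : \pi_Q x = \pi_Q y <-> f i x = f i y.
  have -> : (\pi_Q x = \pi_Q y) <-> (x - y \in additive_ker (f i)).
    by rewrite Quotient.idealrBE; split=> [->|/eqP].
  rewrite unfold_in /additive_ker raddfB subr_eq0; split=> [/eqP|->] //.
pose phi (q : Q) : seq_colim f := seq_colim_in f (repr q).
have phiE x : phi (\pi_Q x) = seq_colim_in f x.
  rewrite /phi -seq_colim_in_f -[RHS]seq_colim_in_f; congr seq_colim_in.
  by apply/piE; rewrite reprK.
have phiB : zmod_morphism phi.
  elim/quotW=> x; elim/quotW=> y.
  by rewrite -[_ - _](raddfB \pi_Q) !phiE raddfB.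
pose phiM := GRing.isZmodMorphism.Build Q (seq_colim f) phi phiB.
pose phiA : {additive Q -> seq_colim f} := HB.pack phi phiM.
exists phiA; split; last exact: phiE.
have phi_inj : injective phi.
  elim/quotW=> x; elim/quotW=> y; rewrite !phiE => xy; apply/piE.
  apply/subr0_eq; rewrite -raddfB; apply: ker.
  apply: (etrans (raddfB (@seq_colim_in V f i) x y)); apply/eqP; rewrite subr_eq0.
  exact/eqP.
have phi_surj c : exists q, phi q = c.
  by have [x <-] := surj c; exists (\pi_Q x); rewrite phiE.
exists (fun c => projT1 (cid (phi_surj c))) => [q | c] /=.
  by apply: phi_inj; case: cid.
by case: cid.
Qed.

(** * The equivalence *)

Section Equivalence.
Variables (k : comPzRingType) (T : triCategory k) (G : T).
Hypothesis HG : classically_generated_by G.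
Variable H : presheaf T.
Hypothesis Hcoh : cohomological H.

Section Construction.
Hypothesis lfpH : locally_finitely_presented H.

Definition covers (A : T) (a : H A) : Prop :=
  forall i (y : H (shiftz G i)), exists x : Mor (shiftz G i) A, pmap H x a = y.

(** The states of the recursive construction of [A 0 -> A 1 -> ...]. *)
Definition cover : Type := {A : T & {a : H A | covers a}}.
Definition cover_obj (c : cover) : T := projT1 c.
Definition cover_elt (c : cover) : H (cover_obj c) := proj1_sig (projT2 c).

Lemma cover_exists : exists c : cover, True.
Proof.
have [D [alpha alphaS]] := proj1 lfpH G.
have cov : covers (alpha D (idmor D)).
  by move=> i y; have [x <-] := alphaS i y; exists x; rewrite -yoneda_natE.
by exists (existT _ D (exist _ _ cov)).
Qed.

(** One step of the construction: take the cone of a map that generates, at the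
    shifts of [G], the kernel of [Hom(-, A) -> H]. Surjectivity of the new map is
    inherited from the old one, which factors through it. *)
Lemma cover_next (c : cover) : exists (c' : cover) (g : Mor (cover_obj c) (cover_obj c')),
  pmap H g (cover_elt c') = cover_elt c /\
  forall i (x : Mor (shiftz G i) (cover_obj c)),
    pmap H x (cover_elt c) = 0 -> g <o> x = 0.
Proof.
case: c => A [a acov]; rewrite /cover_elt /cover_obj /=.
have [D [alpha alphaS]] := proj2 lfpH A (yoneda_nat a) G.
pose d : Mor D A := ker_val (alpha D (idmor D)).
have [A' [g [h dgh]]] := TR1_cone d.
have /(Hcoh dgh)[a' a'E] : pmap H d a = 0.
  exact/eqP/(valP (alpha D (idmor D))).
have a'cov : covers a'.
  by move=> i y; have [x <-] := acov i y; exists (g <o> x); rewrite pmap_comp a'E.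
exists (existT _ A' (exist _ a' a'cov)), g; split=> // i x x0.
have xker : (x : yoneda A (shiftz G i)) \in ker_pred (yoneda_nat a (shiftz G i)).
  exact/eqP.
have [y /(congr1 (@ker_val _ _ _ _))] := alphaS i (LinearKer xker).
rewrite yoneda_natE /= => <-.
by rewrite /precomp compmA (dist_comp0 dgh) comp0m.
Qed.

Lemma lfp_almost_constant : exists (A : nat -> T) (f : forall i, Mor (A i) (A i.+1)),
    almost_constant_on (fun X => exists i : int, X = shiftz G i) f /\
    exists phi : natTrans (colim_presheaf (fun i => yoneda_map (f i))) H,
      nat_iso phi.
Proof.
pose next c := projT1 (cid (cover_next c)).
pose c n := iter n next (projT1 (cid cover_exists)).
pose A n := cover_obj (c n).
pose f n : Mor (A n) (A n.+1) := projT1 (cid (projT2 (cid (cover_next (c n))))).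
pose a n : H (A n) := cover_elt (c n).
have fP n := projT2 (cid (projT2 (cid (cover_next (c n))))).
have fa n : pmap H (f n) (a n.+1) = a n by exact: (proj1 (fP n)).
have fker n i (x : Mor (shiftz G i) (A n)) : pmap H x (a n) = 0 -> f n <o> x = 0.
  exact: (proj2 (fP n)).
have cov n : covers (a n) by exact: (proj2_sig (projT2 (c n))).
have PG i : approximates f a 1 (shiftz G i).
  split=> [n _ | n m nm x x0]; first exact: cov.
  rewrite addn1 in nm; rewrite -(trans_comp f (leqnSn n) nm) -compmA trans_step.
  by rewrite fker // compm0.
exists A, f; split; last first.
  exists (colim_nat fa); apply: colim_ev_iso => X.
  have [N /(_ (Posz 0)) PN] := approximates_everywhere Hcoh fa HG
    (ex_intro _ _ PG) X.
  by exists N.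
move=> X [i ->]; apply/almost_constantP => n; split=> [c' | x x0].
  have [x xE] := cov n i (colim_ev fa c'); exists x.
  pose d : colim_presheaf (fun i => yoneda_map (f i)) (shiftz G i) :=
    lin_colim_in (fun j => yoneda_map (f j) (shiftz G i)) x.
  suff /subr0_eq : d - c' = 0 by [].
  apply: (colim_ev_inj (PG i)).
  apply: (etrans (linearB (@colim_ev k T H A f a fa (shiftz G i)) d c')).
  by apply/eqP; rewrite subr_eq0; apply/eqP; rewrite -[RHS]xE; apply: colim_evE.
apply: fker; rewrite -(colim_evE fa).
apply: etrans (linear0 (@colim_ev k T H A f a fa (shiftz G i))).
by congr colim_ev; exact: x0.
Qed.

End Construction.

Lemma almost_constant_lfp (A : nat -> T) (f : forall i, Mor (A i) (A i.+1))
    (phi : natTrans (colim_presheaf (fun i => yoneda_map (f i))) H) :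
  almost_constant_on (fun X => exists i : int, X = shiftz G i) f ->
  nat_iso phi -> locally_finitely_presented H.
Proof.
move=> fac [psi [phiK psiK]].
pose a i : H (A i) :=
  phi (A i) (lin_colim_in (fun i => yoneda_map (f i) _) (idmor (A i))).
have aE X i (x : Mor X (A i)) :
    pmap H x (a i) = phi X (lin_colim_in (fun i => yoneda_map (f i) X) x).
  by rewrite /a -ncomp_natural /= lin_colim_map_in /= /precomp comp1m.
have fa i : pmap H (f i) (a i.+1) = a i.
  rewrite aE /a -(lin_colim_in_f (fun j => yoneda_map (f j) (A i)) (idmor (A i))).
  by rewrite /= /postcomp compm1.
apply: (approximates_lfp fa); apply: (approximates_everywhere Hcoh fa HG).
exists 1%N => j.
have /almost_constantP acG := fac _ (ex_intro _ j erefl).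
split=> [n _ y | n m nm x].
  have [x xE] := proj1 (acG n) (psi _ y); exists x.
  by rewrite aE -[RHS]psiK; exact: (congr1 (phi (shiftz G j)) xE).
rewrite aE => x0; rewrite addn1 in nm.
rewrite -(trans_comp f (leqnSn n) nm) -compmA trans_step.
suff -> : f n <o> x = 0 by rewrite compm0.
apply: (proj2 (acG n)); rewrite -[LHS](phiK (shiftz G j)).
by rewrite [X in psi _ X]x0 linear0.
Qed.

End Equivalence.

Theorem proposition4p15 (k : comPzRingType) (T : triCategory k) (G : T)
    (HG : classically_generated_by G)
    (H : presheaf T) (Hcoh : cohomological H) :
  locally_finitely_presented H <->
  exists (A : nat -> T) (f : forall i, Mor (A i) (A i.+1)),
    almost_constant_on (fun X => exists i : int, X = shiftz G i) f /\
    exists phi : natTrans (colim_presheaf (fun i => yoneda_map (f i))) H,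
      nat_iso phi.
Proof.
split; first exact: lfp_almost_constant.
by case=> A [f [fac [phi phi_iso]]]; exact: (almost_constant_lfp HG Hcoh fac phi_iso).
Qed.
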